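(* Let $\varepsilon>0$, $c>0$, $\delta\ge 0$, $\gamma\in(0,1)$ and $T\ge e^{\varepsilon}$ be real numbers, and let $K\ge 1$ be an integer. Let $\mathcal{A}$ be an oracle algorithm (which only outputs tuples it received from its oracle calls) satisfying the following properties for all $D$, $n$, $R$ and every $\varepsilon$-DP mechanism $\mathcal{M}: D^n\times[K]\to R\times\mathbb{R}$: (Privacy) $\mathcal{A}^{\mathcal{M}}: D^n\to R\times\mathbb{R}$ is $(c\varepsilon,\delta)$-DP. (Utility) For every input $d\in D^n$, $\Pr[\mathrm{val}(\mathcal{A}^{\mathcal{M}}(d))\ge \max_{k\in[K]}\mathrm{Median}(\mathrm{val}(\mathcal{M}(d,k)))]\ge 1-\gamma$. (Runtime) For every input $d\in D^n$, $\mathcal{A}^{\mathcal M}$ on input $d$ makes at most $TK$ calls to $\mathcal{M}$ in expectation, where the calls may be on any inputs in $D^n\times[K]$. Then, if $\varepsilon\le 3$ and $\delta<\frac{\varepsilon\gamma}{40\ln(8T)}$, we have $T\ge \frac{1}{8}(8\gamma)^{-\frac{1}{40c}}$, or equivalently, $c\ge \frac{\ln\frac{1}{8\gamma}}{40\ln(8T)}$.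
   Context: For a set $D$ and integer $n\ge1$, a dataset is an element of $D^n$; the Hamming distance $|d-d'|_H$ is the number of entries in which $d,d'$ differ, and $d,d'$ are neighboring if $|d-d'|_H=1$. A randomized algorithm (mechanism) $\mathcal{M}$ on $D^n$ is $(\varepsilon,\delta)$-differentially private (DP) if for all neighboring $d,d'$ and all (measurable) sets $S$ of outputs, $\Pr[\mathcal{M}(d)\in S]\le e^{\varepsilon}\Pr[\mathcal{M}(d')\in S]+\delta$; $\varepsilon$-DP means $(\varepsilon,0)$-DP. $[K]=\{1,\dots,K\}$ is the set of hyperparameter settings; a mechanism $\mathcal{M}: D^n\times[K]\to R\times\mathbb{R}$ is $\varepsilon$-DP if $\mathcal{M}(\cdot,k)$ is $\varepsilon$-DP for every $k\in[K]$. Mechanisms here output a tuple $(o,v)\in R\times\mathbb{R}$, where $R$ is an arbitrary output space and $v$ is a quality score; $\mathrm{val}((o,v))=v$. $\mathrm{Median}(\mathrm{val}(\mathcal{M}(d,k)))=\sup\{z:\Pr_{(o,v)\sim\mathcal{M}(d,k)}[v\ge z]\ge \tfrac12\}$. An oracle algorithm $\mathcal{A}$ takes a dataset $d\in D^n$ and has black-box oracle access to $\mathcal{M}$: it may adaptively call $\mathcal{M}$ on pairs (dataset, element of $[K]$), each call returning a fresh independent sample of $\mathcal{M}$'s output on that pair. Standing assumption: the output of $\mathcal{A}^{\mathcal{M}}$ is always one of the tuples $(o,v)$ returned by one of its calls to $\mathcal{M}$. Probabilities and expectations are over the randomness of both $\mathcal{A}$ and $\mathcal{M}$. *)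

(* Defs.v *)
From HB Require Import structures.
From mathcomp Require Import all_boot all_order all_algebra.
From mathcomp Require Import all_classical all_reals all_analysis.

Set Implicit Arguments.
Unset Strict Implicit.
Unset Printing Implicit Defensive.
Import Order.TTheory GRing.Theory Num.Theory.

Local Open Scope classical_set_scope.
Local Open Scope ring_scope.

Definition hamming (D : eqType) (n : nat) (d d' : n.-tuple D) : nat :=
  #|[set i : 'I_n | tnth d i != tnth d' i]%SET|.

Definition neighboring (D : eqType) (n : nat) (d d' : n.-tuple D) : Prop :=
  hamming d d' = 1%N.

(* [P d S] is the probability that the output on dataset [d] lies in [S]. *)
Definition diff_private (R : realType) (D : eqType) (n : nat)
    (dX : measure_display) (X : measurableType dX) (eps delta : R)
    (P : n.-tuple D -> set X -> \bar R) : Prop :=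
  forall d d' : n.-tuple D, neighboring d d' ->
  forall S : set X, measurable S ->
  (P d S <= (expR eps)%:E * P d' S + delta%:E)%E.

(* [M k d] is the output distribution of the mechanism on [(d, k)].  It has to
   be a kernel in [d], since an algorithm may query random datasets; this is
   no restriction when [D] is countable with the discrete sigma-algebra. *)
Definition mechanism_private (R : realType) (K n : nat)
    (dD : measure_display) (D : measurableType dD)
    (dX : measure_display) (X : measurableType dX) (eps : R)
    (M : 'I_K -> R.-pker (n.-tuple D) ~> X) : Prop :=
  forall k : 'I_K, diff_private eps 0 (fun d S => M k d S).

(* The set of such [z] is nonempty and bounded above when [mu] is a
   probability measure, so this supremum is then a real number. *)
Definition median (R : realType) (dO : measure_display)
    (O : measurableType dO) (mu : set (O * R) -> \bar R) : \bar R :=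
  ereal_sup [set z%:E | z in
    [set z : R | ((2^-1)%:E <= mu [set ov | (z <= ov.2)%R])%E]].

(* After [m] oracle calls an algorithm either calls the mechanism again, on
   a dataset [q] and an index [k], or returns one of the [m] tuples it has
   received; in particular it cannot return before its first call. *)
Variant action (D : Type) (n K m : nat) : Type :=
| Query (q : n.-tuple D) (k : 'I_K)
| Return (i : 'I_m).

Arguments Query {D n K m} q k.
Arguments Return {D n K m} i.

(* An oracle algorithm draws a random tape once and for all; its next action
   is a function of its input, its tape and the answers received so far,
   listed most recent first.  Past queries need not be recorded, since these
   data determine them.  The measurability conditions say that, for each
   input and each number of calls, the action is a measurable function of
   the tape and the answers. *)
Record oracle_alg (R : realType) (K n : nat)
    (dD : measure_display) (D : measurableType dD)
    (dX : measure_display) (X : measurableType dX) := OracleAlg {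
  tape_display : measure_display ;
  tape : measurableType tape_display ;
  tape_law : probability tape R ;
  act : n.-tuple D -> tape -> forall m : nat, m.-tuple X -> action D n K m ;
  measurable_act_query : forall (d : n.-tuple D) (m : nat) (k : 'I_K)
      (B : set (n.-tuple D)), measurable B ->
    measurable [set x : tape * m.-tuple X |
      exists2 q, B q & act d x.1 x.2 = Query q k] ;
  measurable_act_return : forall (d : n.-tuple D) (m : nat) (i : 'I_m),
    measurable [set x : tape * m.-tuple X | act d x.1 x.2 = Return i]
}.

Section Execution.
Context (R : realType) (K n : nat)
  (dD : measure_display) (D : measurableType dD)
  (dX : measure_display) (X : measurableType dX).
Variables (A : oracle_alg R K n D X)
  (M : 'I_K -> R.-pker (n.-tuple D) ~> X).

(* Run with tape [w] from the history [h].  The value is the expectation,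
   over fresh samples of [M], of [f] applied to the history after [N] further
   calls, executions that return before the [N]-th of these counting as 0. *)
Fixpoint run (d : n.-tuple D) (w : tape A)
    (f : forall m : nat, m.-tuple X -> \bar R) (N m : nat) (h : m.-tuple X)
    {struct N} : \bar R :=
  match N with
  | 0%N => f m h
  | N'.+1 =>
    match act d w h with
    | Query q k => (\int[M k q]_x run d w f N' [tuple of x :: h])%E
    | Return _ => 0%E
    end
  end.

Definition returns_in (d : n.-tuple D) (w : tape A) (S : set X)
    (m : nat) (h : m.-tuple X) : \bar R :=
  match act d w h with
  | Query _ _ => 0%E
  | Return i => (\1_S (tnth h i))%:E
  end.

(* Probability that the execution on [d] terminates with output in [S],
   split according to the number [N] of calls made. *)
Definition output_prob (d : n.-tuple D) (S : set X) : \bar R :=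
  (\sum_(0 <= N <oo)
     \int[tape_law A]_w run d w (returns_in d w S) N [tuple])%E.

(* The sum over [N] of the probability that at least [N + 1] calls are made;
   a nonterminating execution makes infinitely many calls. *)
Definition expected_calls (d : n.-tuple D) : \bar R :=
  (\sum_(0 <= N <oo)
     \int[tape_law A]_w run d w (fun _ _ => 1%E) N.+1 [tuple])%E.

End Execution.

(* Main.v *)
(** Take [D = bool], a secret index [kappa] and a secret dataset [e], and
    consider the mechanism which on [(d, k)] answers 1 with probability
    [exp (- eps |d - e|) / 2] if [k = kappa], and answers 0 in all other cases.
    On input [e], utility forces the output 1 except with probability [gamma].
    On input [0^n] all queries are made blindly until an answer 1 is received;
    as a fixed query is answered 1 with probability
    [((1 + exp (- eps)) / 2)^n / (2 K)] on average over [(kappa, e)], some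
    choice of [(kappa, e)] makes the output 1 unlikely as soon as
    [n eps >= 8 ln T].  Group privacy along the at most [n] steps from [0^n] to
    [e] then bounds [gamma] from below. *)

Require Import Defs.
From HB Require Import structures.
From mathcomp Require Import all_boot all_order all_algebra.
From mathcomp Require Import all_classical all_reals all_analysis.
From mathcomp Require Import measurable_realfun ring lra.

Set Implicit Arguments.
Unset Strict Implicit.
Unset Printing Implicit Defensive.
Import Order.TTheory GRing.Theory Num.Theory.

Local Open Scope classical_set_scope.
Local Open Scope ring_scope.

(** * Two-outcome mechanisms *)

(** A singleton is a finite intersection of coordinate preimages, and there are finitely many
    tuples. Any function of the dataset is therefore measurable, so [coin] is a kernel for an
    arbitrary [p]. *)
Lemma measurable_bool_tuple (n : nat) (S : set (n.-tuple bool)) : measurable S.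
Proof.
have m1 (t : n.-tuple bool) : measurable [set t].
  rewrite (_ : [set t] =
      \bigcap_(i in [set: 'I_n]) ((@tnth n bool ^~ i) @^-1` [set tnth t i])).
    apply: fin_bigcap_measurable; first exact: finite_finset.
    move=> i _; rewrite -[X in measurable X]setTI.
    exact: measurable_tnth.
  apply/seteqP; split=> [u -> // | u ut].
  by apply: eq_from_tnth => i; exact: ut.
rewrite (_ : S = \bigcup_(t in S) [set t]).
  by apply: fin_bigcup_measurable => //; exact: finite_finset.
by apply/seteqP; split=> [t St|_ [t St ->]//]; exists t.
Qed.

Definition answer (R : realType) (b : bool) : unit * R := (tt, b%:R).

Section Coin_mechanism.
Context (R : realType) (n : nat).

Lemma measurable_answer : measurable_fun [set: bool] (@answer R).
Proof. by []. Qed.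

HB.instance Definition _ :=
  @isMeasurableFun.Build _ _ bool (unit * R)%type (@answer R) measurable_answer.

(** [bernoulli_prob] is a probability for every real parameter, so the kernel structure carries no
    condition on [p]; the bounds [0 <= p q <= 1] are required only by the explicit formulas. *)
Definition coin (p : n.-tuple bool -> R) (q : n.-tuple bool) :
    {measure set (unit * R) -> \bar R} :=
  distribution (bernoulli_prob (p q)) (@answer R).

Lemma measurable_coin (p : n.-tuple bool -> R) (U : set (unit * R)) :
  measurable U -> measurable_fun [set: n.-tuple bool] (coin p ^~ U).
Proof. by move=> _ _ B _; exact: measurable_bool_tuple. Qed.

HB.instance Definition _ (p : n.-tuple bool -> R) :=
  isKernel.Build _ _ (n.-tuple bool) (unit * R)%type R (coin p)
    (measurable_coin p).

Lemma coin_setT (p : n.-tuple bool -> R) (q : n.-tuple bool) :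
  coin p q [set: unit * R] = 1%E.
Proof. exact: probability_setT. Qed.

HB.instance Definition _ (p : n.-tuple bool -> R) :=
  Kernel_isProbability.Build _ _ (n.-tuple bool) (unit * R)%type R (coin p)
    (coin_setT p).

Lemma integral_coin (p : n.-tuple bool -> R) (q : n.-tuple bool)
    (f : unit * R -> R) : 0 <= p q <= 1 -> measurable_fun setT f ->
  (forall x, 0 <= f x) ->
  (\int[coin p q]_x (f x)%:E)%E =
  (p q * f (answer R true) + (1 - p q) * f (answer R false))%:E.
Proof.
move=> p01 mf f0.
rewrite ge0_integral_distribution//=; last exact/measurable_EFinP.
by rewrite integral_bernoulli_prob//= => b; rewrite lee_fin.
Qed.

Lemma coinE (p : n.-tuple bool -> R) (q : n.-tuple bool) (S : set (unit * R)) :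
  0 <= p q <= 1 ->
  coin p q S =
  (p q * \1_S (answer R true) + (1 - p q) * \1_S (answer R false))%:E.
Proof.
by move=> p01; rewrite /coin /distribution /pushforward/= bernoulli_probE.
Qed.

End Coin_mechanism.

Definition coin_mechanism (R : realType) (K n : nat)
    (p : 'I_K -> n.-tuple bool -> R) (k : 'I_K) :
  R.-pker (n.-tuple bool) ~> (unit * R)%type := coin (p k).

(** * Executions on two-outcome mechanisms *)

Section Coin_run.
Context (R : realType) (K n : nat).
Local Notation X := (unit * R)%type.
Variables (A : oracle_alg R K n bool X) (d : n.-tuple bool).
Implicit Types (p : 'I_K -> n.-tuple bool -> R) (w : tape A).

(* [coin_run p F] computes [run] on [coin_mechanism p]; here the function [F]
   of the history may also depend on the tape. *)
Fixpoint coin_run p (F : tape A -> forall m, m.-tuple X -> R) w (N m : nat)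
    (h : m.-tuple X) {struct N} : R :=
  if N is N'.+1 then
    match act d w h with
    | Query q k =>
        p k q * coin_run p F w N' [tuple of answer R true :: h] +
        (1 - p k q) * coin_run p F w N' [tuple of answer R false :: h]
    | Return _ => 0
    end
  else F w m h.

Definition returns_ind (S : set X) w m (h : m.-tuple X) : R :=
  match act d w h with Query _ _ => 0 | Return i => \1_S (tnth h i) end.

(** For [g = p] this is the conditional probability, given the history, that the next action is a
    call answered positively. *)
Definition query_weight (g : 'I_K -> n.-tuple bool -> R) w m
    (h : m.-tuple X) : R :=
  match act d w h with Query q k => g k q | Return _ => 0 end.

(** All lengths are taken together because each call lengthens the history, so an induction on the
    number of calls changes [m]. *)
Definition hist_measurable (F : tape A -> forall m, m.-tuple X -> R) :=
  forall m, measurable_fun [set: tape A * m.-tuple X] (fun x => F x.1 m x.2).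

(** There are finitely many pairs [(k, q)], so the case analysis on the action is a finite sum of
    indicators of measurable events times measurable functions. *)
Lemma measurable_query m
    (G : 'I_K -> n.-tuple bool -> tape A * m.-tuple X -> R) :
  (forall k q, measurable_fun setT (G k q)) ->
  measurable_fun [set: tape A * m.-tuple X]
    (fun x => match act d x.1 x.2 with
              | Query q k => G k q x | Return _ => 0 end).
Proof.
move=> mG.
pose E (k : 'I_K) (q : n.-tuple bool) := [set x : tape A * m.-tuple X |
  exists2 q', [set q] q' & act d x.1 x.2 = Query q' k].
have mE k q : measurable (E k q).
  by apply: measurable_act_query; exact: measurable_bool_tuple.
rewrite (_ : (fun x => _) =
    (fun x => \sum_(k < K) \sum_(q : n.-tuple bool) \1_(E k q) x * G k q x)).
  apply: measurable_sum => k; apply: measurable_sum => q.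
  by apply: measurable_funM => //; exact/measurable_indicP.
apply/funext => x; case act_x : (act d x.1 x.2) => [q k|i].
  rewrite (bigD1 k)//= (bigD1 q)//=.
  rewrite [X in _ + X + _]big1 ?[X in _ + X]big1 ?addr0.
  - by rewrite indicE mem_set ?mul1r//; exists q.
  - move=> k' k'k; apply: big1 => q' _.
    rewrite indicE memNset ?mul0r// => -[q0 _].
    by rewrite act_x => -[_ kk']; rewrite kk' eqxx in k'k.
  - move=> q' q'q; rewrite indicE memNset ?mul0r// => -[q0 ->].
    by rewrite act_x => -[qq']; rewrite qq' eqxx in q'q.
rewrite big1// => k _; rewrite big1// => q _.
by rewrite indicE memNset ?mul0r// => -[q0 _]; rewrite act_x.
Qed.

Lemma measurable_returns_ind (S : set X) :
  measurable S -> hist_measurable (returns_ind S).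
Proof.
move=> mS m; rewrite /returns_ind.
pose E (i : 'I_m) := [set x : tape A * m.-tuple X | act d x.1 x.2 = Return i].
rewrite (_ : (fun x => _) =
    (fun x => \sum_(i < m) \1_(E i) x * \1_S (tnth x.2 i))).
  apply: measurable_sum => i; apply: measurable_funM.
    by apply/measurable_indicP; exact: measurable_act_return.
  apply: measurableT_comp; first exact/measurable_indicP.
  by apply: (measurableT_comp (measurable_tnth i)); exact: measurable_snd.
apply/funext => x; case act_x : (act d x.1 x.2) => [q k|i].
  rewrite big1// => i _.
  by rewrite indicE memNset ?mul0r//; rewrite /E/= act_x.
rewrite (bigD1 i)//= big1 ?addr0.
- by rewrite [X in X * _]indicE mem_set ?mul1r.
- move=> j ji; rewrite [X in X * _]indicE memNset ?mul0r//.
  by rewrite /E/= act_x => -[ij]; rewrite ij eqxx in ji.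
Qed.

Lemma measurable_query_weight (g : 'I_K -> n.-tuple bool -> R) :
  hist_measurable (query_weight g).
Proof.
by move=> m; apply: (@measurable_query m (fun k q _ => g k q)).
Qed.

Lemma measurable_tape_cons m (x : X) :
  measurable_fun [set: tape A * m.-tuple X]
    (fun y => (y.1, [tuple of x :: y.2]) : tape A * m.+1.-tuple X).
Proof.
apply/measurable_fun_pairP; split => /=; first exact: measurable_fst.
by apply: measurable_cons => //; exact: measurable_snd.
Qed.

Lemma measurable_coin_run p (F : tape A -> forall m, m.-tuple X -> R) N :
  hist_measurable F ->
  hist_measurable (fun w => @coin_run p F w N).
Proof.
move=> mF; elim: N => [|N IHN] m /=; first exact: mF.
pose next b (x : tape A * m.-tuple X) :=
  coin_run p F x.1 N [tuple of answer R b :: x.2].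
have mnext b : measurable_fun setT (next b).
  have mN : measurable_fun setT
    (fun x : tape A * m.+1.-tuple X => coin_run p F x.1 N x.2) := IHN m.+1.
  exact: (measurableT_comp mN (@measurable_tape_cons m (answer R b))).
apply: (@measurable_query m
  (fun k q x => p k q * next true x + (1 - p k q) * next false x)) => k q.
by apply: measurable_funD; apply: measurable_funM.
Qed.

Lemma coin_run_ge0 p (F : tape A -> forall m, m.-tuple X -> R) w N m
    (h : m.-tuple X) :
  (forall k q, 0 <= p k q <= 1) -> (forall m (h : m.-tuple X), 0 <= F w m h) ->
  0 <= coin_run p F w N h.
Proof.
move=> p01 F0; elim: N m h => [|N IHN] m h //=.
case: act => // q k; have /andP[p0 p1] := p01 k q.
by apply: addr_ge0; apply: mulr_ge0; rewrite ?subr_ge0.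
Qed.

(** Each integral against [coin] is a two-term average, which removes all integrals except the one
    over the tape. *)
Lemma run_coin_mechanism p (F : tape A -> forall m, m.-tuple X -> R) f w N m
    (h : m.-tuple X) :
  (forall k q, 0 <= p k q <= 1) -> (forall m (h : m.-tuple X), 0 <= F w m h) ->
  hist_measurable F ->
  (forall m (h : m.-tuple X), f m h = (F w m h)%:E) ->
  run (coin_mechanism p) d w f N h = (coin_run p F w N h)%:E.
Proof.
move=> p01 F0 mF fF; elim: N m h => [|N IHN] m h /=; first exact: fF.
case: act => // q k.
under eq_integral do rewrite IHN.
rewrite integral_coin//.
- have mN : measurable_fun setT
    (fun x : tape A * m.+1.-tuple X => coin_run p F x.1 N x.2) :=
    @measurable_coin_run p F N mF m.+1.
  apply: (measurableT_comp (measurableT_comp mN (measurable_pair1 w))).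
  by apply: measurable_cons.
- by move=> x; exact: coin_run_ge0.
Qed.

Lemma eq_coin_run p (F G : tape A -> forall m, m.-tuple X -> R) w N m
    (h : m.-tuple X) :
  (forall m (h : m.-tuple X), F w m h = G w m h) ->
  coin_run p F w N h = coin_run p G w N h.
Proof.
move=> FG; elim: N m h => [|N IHN] m h //=.
by case: act => // q k; rewrite !IHN.
Qed.

Lemma le_coin_run p (F G : tape A -> forall m, m.-tuple X -> R) w N m
    (h : m.-tuple X) :
  (forall k q, 0 <= p k q <= 1) ->
  (forall m (h : m.-tuple X), F w m h <= G w m h) ->
  coin_run p F w N h <= coin_run p G w N h.
Proof.
move=> p01 FG; elim: N m h => [|N IHN] m h //=.
case: act => // q k; have /andP[p0 p1] := p01 k q.
by apply: lerD; apply: ler_wpM2l; rewrite ?subr_ge0.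
Qed.

Lemma coin_runD p (F G : tape A -> forall m, m.-tuple X -> R) w N m
    (h : m.-tuple X) :
  coin_run p (fun w m h => F w m h + G w m h) w N h =
  coin_run p F w N h + coin_run p G w N h.
Proof.
elim: N m h => [|N IHN] m h //=.
by case: act => [q k|i]; rewrite ?addr0// !IHN; ring.
Qed.

Lemma coin_runZ p (c : R) (F : tape A -> forall m, m.-tuple X -> R) w N m
    (h : m.-tuple X) :
  coin_run p (fun w m h => c * F w m h) w N h = c * coin_run p F w N h.
Proof.
elim: N m h => [|N IHN] m h //=.
by case: act => [q k|i]; rewrite ?mulr0// !IHN; ring.
Qed.

Lemma coin_run_sum p (I : Type) (r : seq I)
    (F : I -> tape A -> forall m, m.-tuple X -> R) w N m (h : m.-tuple X) :
  coin_run p (fun w m h => \sum_(i <- r) F i w m h) w N h =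
  \sum_(i <- r) coin_run p (F i) w N h.
Proof.
elim: r => [|i r IHr].
  rewrite big_nil -[RHS](mul0r (coin_run p (fun _ _ _ => 0) w N h)) -coin_runZ.
  by apply: eq_coin_run => k g; rewrite big_nil mul0r.
rewrite big_cons -IHr -coin_runD.
by apply: eq_coin_run => k g; rewrite big_cons.
Qed.

(* A run still active before its [N]-th call either returns there or makes
   that call. *)
Lemma coin_run_alive p w N m (h : m.-tuple X) :
  coin_run p (returns_ind setT) w N h + coin_run p (fun _ _ _ => 1) w N.+1 h =
  coin_run p (fun _ _ _ => 1) w N h.
Proof.
elim: N m h => [|N IHN] m h.
  by rewrite /= /returns_ind; case: act => [q k|i]; rewrite ?indicT/=; ring.
have E b := IHN _ [tuple of answer R b :: h]; move: E => /=.
case: (act d w h) => [q k E|i _]; last by rewrite addr0.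
by rewrite -!E; ring.
Qed.

(** [coin_run_alive] telescopes: the mass missing from 1 is that of the runs that are still
    active. *)
Lemma sum_coin_run_setT p w N m (h : m.-tuple X) :
  \sum_(i < N) coin_run p (returns_ind setT) w i h =
  1 - coin_run p (fun _ _ _ => 1) w N h.
Proof.
elim: N => [|N IHN]; first by rewrite big_ord0 /= subrr.
rewrite big_ord_recr IHN -(coin_run_alive p w N h).
move: (coin_run _ (returns_ind _) _ _ _) (coin_run _ _ _ N.+1 _) => a b /=.
by ring.
Qed.

Lemma returns_ind_ge0 S w m (h : m.-tuple X) : 0 <= returns_ind S w h.
Proof. by rewrite /returns_ind; case: act => // i. Qed.

Lemma sum_coin_run_le1 p S w N m (h : m.-tuple X) :
  (forall k q, 0 <= p k q <= 1) ->
  \sum_(i < N) coin_run p (returns_ind S) w i h <= 1.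
Proof.
move=> p01.
apply: (@le_trans _ _ (\sum_(i < N) coin_run p (returns_ind setT) w i h)).
  apply: ler_sum => i _; apply: le_coin_run => // {}m {}h.
  rewrite /returns_ind; case: act => // j.
  by rewrite indicT indicE lern1 leq_b1.
rewrite sum_coin_run_setT lerBlDr lerDl.
exact: coin_run_ge0.
Qed.

(* Union bound: as long as only negative answers have been received, the run
   follows the one where all answers are negative, and each query made there is
   positively answered with probability [p k q]. *)
Lemma sum_coin_run_hit p S w N m (h : m.-tuple X) :
  (forall k q, 0 <= p k q <= 1) -> ~ S (answer R false) ->
  (forall i, ~ S (tnth h i)) ->
  \sum_(i < N) coin_run p (returns_ind S) w i h <=
  \sum_(i < N) coin_run (fun _ _ => 0) (query_weight p) w i h.
Proof.
move=> p01 S0; elim: N m h => [|N IHN] m h Sh; first by rewrite !big_ord0.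
rewrite !big_ord_recl/= {1}/returns_ind {1}/query_weight.
case: act => [q k|i]; last first.
  by rewrite indicE memNset// !big1.
have /andP[p0 p1] := p01 k q.
have IH1 := @sum_coin_run_le1 p S w N _ [tuple of answer R true :: h] p01.
have IH0 : \sum_(i < N) coin_run p (returns_ind S) w i
             [tuple of answer R false :: h] <=
           \sum_(i < N) coin_run (fun _ _ => 0) (query_weight p) w i
             [tuple of answer R false :: h].
  apply: IHN => i; case: (unliftP ord0 i) => [j|] ->.
    by rewrite tnthS.
  by rewrite tnth0.
(* After a positive answer the remaining sum is at most 1 and contributes at most [p k q]. After a
   negative one it is nonnegative, so its factor [1 - p k q] can be bounded by 1 before the
   induction hypothesis applies. *)
have Q0 : 0 <= \sum_(i < N) coin_run p (returns_ind S) w i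
             [tuple of answer R false :: h].
  apply: sumr_ge0 => i _; apply: coin_run_ge0 => // *.
  exact: returns_ind_ge0.
under [X in _ <= _ + X]eq_bigr do rewrite mul0r subr0 mul1r !add0r.
under [X in _ + X <= _]eq_bigr do rewrite add0n.
rewrite big_split/= -!mulr_sumr add0r.
nra.
Qed.

(** A constant weight is collected exactly when one more call is made; summed over [N], this turns
    the union bound into [c] times the expected number of calls. *)
Lemma coin_run_query_cst p (c : R) w N m (h : m.-tuple X) :
  coin_run p (query_weight (fun _ _ => c)) w N h =
  c * coin_run p (fun _ _ _ => 1) w N.+1 h.
Proof.
elim: N m h => [|N IHN] m h.
  by rewrite /= /query_weight; case: act => [q k|i]; ring.
have E b := IHN _ [tuple of answer R b :: h]; move: E => /=.
case: (act d w h) => [q k E|i _]; last by rewrite mulr0.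
by rewrite !E; ring.
Qed.

End Coin_run.
(** * Series of integrals *)

Section Series_of_integrals.
Context (R : realType) (dT : measure_display) (Omega : measurableType dT)
  (P : probability Omega R).
Implicit Types u v : nat -> Omega -> R.
Local Open Scope ereal_scope.

Lemma nneseries_le_of_partial (a : nat -> \bar R) (C : \bar R) :
  (forall N, 0 <= a N) -> (forall J, \sum_(N < J) a N <= C) ->
  \sum_(0 <= N <oo) a N <= C.
Proof.
move=> a0 aC; apply: lime_le; first exact: is_cvg_nneseries.
by apply: nearW => J; rewrite big_mkord.
Qed.

Lemma sum_integral u (J : nat) :
  (forall N, measurable_fun setT (u N)) -> (forall N w, (0 <= u N w)%R) ->
  \sum_(N < J) \int[P]_w (u N w)%:E = \int[P]_w (\sum_(N < J) u N w)%:E.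
Proof.
move=> mu u0; rewrite -ge0_integral_sum//.
- by apply: eq_integral => w _; rewrite sumEFin.
- by move=> N; exact/measurable_EFinP.
- by move=> N w _; rewrite lee_fin.
Qed.

(** Only partial sums are compared, since [sum_coin_run_hit] does not hold term by term: a positive
    answer is received at an earlier index than the return that outputs it. *)
Lemma le_series_integral u v :
  (forall N, measurable_fun setT (u N)) -> (forall N w, (0 <= u N w)%R) ->
  (forall N, measurable_fun setT (v N)) -> (forall N w, (0 <= v N w)%R) ->
  (forall J w, (\sum_(N < J) u N w <= \sum_(N < J) v N w)%R) ->
  \sum_(0 <= N <oo) \int[P]_w (u N w)%:E <=
  \sum_(0 <= N <oo) \int[P]_w (v N w)%:E.
Proof.
move=> mu u0 mv v0 uv; apply: nneseries_le_of_partial => [N|J].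
  by apply: integral_ge0 => w _; rewrite lee_fin.
apply: (@le_trans _ _ (\sum_(N < J) \int[P]_w (v N w)%:E)).
  rewrite !sum_integral//; apply: ge0_le_integral => //.
  - by move=> w _; rewrite lee_fin sumr_ge0.
  - by apply/measurable_EFinP; exact: measurable_sum.
  - by apply/measurable_EFinP; exact: measurable_sum.
  - by move=> w _; rewrite lee_fin.
rewrite -(big_mkord xpredT (fun N => \int[P]_w (v N w)%:E)).
apply: nneseries_lim_ge => N _ _.
by apply: integral_ge0 => w _; rewrite lee_fin.
Qed.

Lemma series_integral_le1 u :
  (forall N, measurable_fun setT (u N)) -> (forall N w, (0 <= u N w)%R) ->
  (forall J w, (\sum_(N < J) u N w <= 1)%R) ->
  \sum_(0 <= N <oo) \int[P]_w (u N w)%:E <= 1.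
Proof.
move=> mu u0 u1; apply: nneseries_le_of_partial => [N|J].
  by apply: integral_ge0 => w _; rewrite lee_fin.
rewrite sum_integral// [leRHS](_ : 1 = \int[P]_w cst 1 w); last first.
  by rewrite integral_cst// mul1e; exact/esym/probability_setT.
apply: ge0_le_integral => //.
- by move=> w _; rewrite lee_fin sumr_ge0.
- by apply/measurable_EFinP; exact: measurable_sum.
- by move=> w _; rewrite lee_fin.
Qed.

Lemma series_integralD u v :
  (forall N, measurable_fun setT (u N)) -> (forall N w, (0 <= u N w)%R) ->
  (forall N, measurable_fun setT (v N)) -> (forall N w, (0 <= v N w)%R) ->
  \sum_(0 <= N <oo) \int[P]_w (u N w + v N w)%:E =
  \sum_(0 <= N <oo) \int[P]_w (u N w)%:E +
  \sum_(0 <= N <oo) \int[P]_w (v N w)%:E.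
Proof.
move=> mu u0 mv v0; rewrite -nneseriesD.
- apply: eq_eseriesr => N _; under eq_integral do rewrite EFinD.
  by rewrite ge0_integralD//; try exact/measurable_EFinP;
    move=> w _; rewrite lee_fin.
- by move=> N _ _; apply: integral_ge0 => w _; rewrite lee_fin.
- by move=> N _ _; apply: integral_ge0 => w _; rewrite lee_fin.
Qed.

Lemma series_integralZl (c : R) u : (0 <= c)%R ->
  (forall N, measurable_fun setT (u N)) -> (forall N w, (0 <= u N w)%R) ->
  \sum_(0 <= N <oo) \int[P]_w (c * u N w)%:E =
  c%:E * \sum_(0 <= N <oo) \int[P]_w (u N w)%:E.
Proof.
move=> c0 mu u0; rewrite -nneseriesZl.
- apply: eq_eseriesr => N _; under eq_integral do rewrite EFinM.
  rewrite ge0_integralZl//; first exact/measurable_EFinP.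
  by move=> w _; rewrite lee_fin.
- by move=> N _; apply: integral_ge0 => w _; rewrite lee_fin.
Qed.

Lemma series_integral_sum (I : Type) (r : seq I) (u : I -> nat -> Omega -> R) :
  (forall i N, measurable_fun setT (u i N)) ->
  (forall i N w, (0 <= u i N w)%R) ->
  \sum_(i <- r) \sum_(0 <= N <oo) \int[P]_w (u i N w)%:E =
  \sum_(0 <= N <oo) \int[P]_w (\sum_(i <- r) u i N w)%:E.
Proof.
move=> mu u0; rewrite -nneseries_sum.
- apply: eq_eseriesr => N _; rewrite -ge0_integral_sum//.
  + by apply: eq_integral => w _; rewrite sumEFin.
  + by move=> i; exact/measurable_EFinP.
  + by move=> i w _; rewrite lee_fin.
- by move=> i N _; apply: integral_ge0 => w _; rewrite lee_fin.
Qed.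

End Series_of_integrals.

(** * Output probabilities *)

Section Coin_output.
Context (R : realType) (K n : nat).
Local Notation X := (unit * R)%type.
Variables (A : oracle_alg R K n bool X) (d : n.-tuple bool).
Implicit Types (p : 'I_K -> n.-tuple bool -> R) (S : set X).
Local Open Scope ereal_scope.

Lemma measurable_coin_run_nil p (F : tape A -> forall m, m.-tuple X -> R) N :
  hist_measurable F ->
  measurable_fun setT (fun w => coin_run d p F w N [tuple]).
Proof.
move=> mF; have mN : measurable_fun setT
  (fun x : tape A * 0.-tuple X => coin_run d p F x.1 N x.2) :=
  @measurable_coin_run _ _ _ A d p F N mF 0%N.
exact: (measurableT_comp mN (measurable_pair2 [tuple])).
Qed.

Lemma output_prob_coin p S :
  (forall k q, 0 <= p k q <= 1)%R -> measurable S ->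
  output_prob A (coin_mechanism p) d S =
  \sum_(0 <= N <oo)
    \int[tape_law A]_w (coin_run d p (returns_ind d S) w N [tuple])%:E.
Proof.
move=> p01 mS; apply: eq_eseriesr => N _; apply: eq_integral => w _.
apply: run_coin_mechanism => //.
- by move=> m h; exact: returns_ind_ge0.
- exact: measurable_returns_ind.
- by move=> m h; rewrite /returns_in /returns_ind; case: act.
Qed.

Lemma expected_calls_coin p :
  (forall k q, 0 <= p k q <= 1)%R ->
  expected_calls A (coin_mechanism p) d =
  \sum_(0 <= N <oo)
    \int[tape_law A]_w (coin_run d p (fun _ _ _ => 1%R) w N.+1 [tuple])%:E.
Proof.
move=> p01; apply: eq_eseriesr => N _; apply: eq_integral => w _.
exact: (@run_coin_mechanism _ _ _ A d p (fun _ _ _ => 1%R) (fun _ _ => 1)).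
Qed.

Lemma output_prob_ge0 p S :
  (forall k q, 0 <= p k q <= 1)%R -> measurable S ->
  0 <= output_prob A (coin_mechanism p) d S.
Proof.
move=> p01 mS; rewrite output_prob_coin//.
apply: nneseries_ge0 => N _ _; apply: integral_ge0 => w _.
by rewrite lee_fin; apply: coin_run_ge0 => // m h; exact: returns_ind_ge0.
Qed.

Lemma output_prob_le1 p S :
  (forall k q, 0 <= p k q <= 1)%R -> measurable S ->
  output_prob A (coin_mechanism p) d S <= 1.
Proof.
move=> p01 mS; rewrite output_prob_coin//; apply: series_integral_le1.
- move=> N; apply: measurable_coin_run_nil.
  exact: measurable_returns_ind.
- by move=> N w; apply: coin_run_ge0 => // m h; exact: returns_ind_ge0.
- by move=> J w; exact: sum_coin_run_le1.
Qed.

(** The total is the probability of [setT] and not 1, because nonterminating executions belong to no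
    output event. *)
Lemma output_probC p S :
  (forall k q, 0 <= p k q <= 1)%R -> measurable S ->
  output_prob A (coin_mechanism p) d S +
  output_prob A (coin_mechanism p) d (~` S) =
  output_prob A (coin_mechanism p) d setT.
Proof.
move=> p01 mS; have mSC := measurableC mS.
rewrite !output_prob_coin// -series_integralD.
- apply: eq_eseriesr => N _; apply: eq_integral => w _.
  rewrite -coin_runD; congr EFin; apply: eq_coin_run => m h.
  rewrite /returns_ind; case: act => [q k|i]; first by rewrite addr0.
  by rewrite !indicE in_setC in_setT; case: (_ \in S); rewrite ?addr0 ?add0r.
- by move=> N; apply: measurable_coin_run_nil; exact: measurable_returns_ind.
- by move=> N w; apply: coin_run_ge0 => // m h; exact: returns_ind_ge0.
- by move=> N; apply: measurable_coin_run_nil; exact: measurable_returns_ind.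
- by move=> N w; apply: coin_run_ge0 => // m h; exact: returns_ind_ge0.
Qed.

Lemma le_output_prob p S S' :
  (forall k q, 0 <= p k q <= 1)%R -> measurable S -> measurable S' ->
  S `<=` S' ->
  output_prob A (coin_mechanism p) d S <=
  output_prob A (coin_mechanism p) d S'.
Proof.
move=> p01 mS mS' SS'; rewrite !output_prob_coin//; apply: le_series_integral.
- by move=> N; apply: measurable_coin_run_nil; exact: measurable_returns_ind.
- by move=> N w; apply: coin_run_ge0 => // m h; exact: returns_ind_ge0.
- by move=> N; apply: measurable_coin_run_nil; exact: measurable_returns_ind.
- by move=> N w; apply: coin_run_ge0 => // m h; exact: returns_ind_ge0.
move=> J w; apply: ler_sum => i _; apply: le_coin_run => // m h.
rewrite /returns_ind; case: act => // j; rewrite !indicE ler_nat.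
by case: (boolP (tnth h j \in S)) => // /set_mem /SS' /mem_set ->.
Qed.

(** The all-negative run in the union bound is the same for every [i], so the sum over [i] can be
    taken inside it, where each query has total weight [c]. *)
Lemma sum_output_prob_hit (I : finType) (p : I -> 'I_K -> n.-tuple bool -> R)
    (c : R) S :
  (forall i k q, 0 <= p i k q <= 1)%R -> measurable S ->
  ~ S (answer R false) -> (0 <= c)%R ->
  (forall k q, \sum_i p i k q = c)%R ->
  \sum_i output_prob A (coin_mechanism (p i)) d S <=
  c%:E * expected_calls A (coin_mechanism (fun _ _ => 0%R)) d.
Proof.
move=> p01 mS S0 c0 pc.
have z01 (k : 'I_K) (q : n.-tuple bool) : (0 <= (0 : R) <= 1)%R.
  by rewrite lexx ler01.
have qw0 i w m (h : m.-tuple X) : (0 <= query_weight d (p i) w h)%R.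
  by rewrite /query_weight; case: act => // q k; case/andP: (p01 i k q).
have m1 : hist_measurable
    (fun (_ : tape A) (m : nat) (_ : m.-tuple X) => 1%R : R).
  by move=> m; exact: measurable_cst.
apply: (@le_trans _ _ (\sum_i \sum_(0 <= N <oo) \int[tape_law A]_w
    (coin_run d (fun _ _ => 0%R) (query_weight d (p i)) w N [tuple])%:E)).
  apply: lee_sum => i _; rewrite output_prob_coin//; apply: le_series_integral.
  - by move=> N; apply: measurable_coin_run_nil; exact: measurable_returns_ind.
  - by move=> N w; apply: coin_run_ge0 => // m h; exact: returns_ind_ge0.
  - by move=> N; apply: measurable_coin_run_nil; exact: measurable_query_weight.
  - by move=> N w; exact: coin_run_ge0.
  by move=> J w; apply: sum_coin_run_hit => // -[].
rewrite series_integral_sum; last 2 first.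
- by move=> i N; apply: measurable_coin_run_nil; exact: measurable_query_weight.
- by move=> i N w; exact: coin_run_ge0.
rewrite expected_calls_coin// -series_integralZl//; last 2 first.
- by move=> N; exact: (@measurable_coin_run_nil _ _ N.+1).
- by move=> N w; exact: (@coin_run_ge0 _ _ _ _ _ _ _ _ N.+1).
rewrite le_eqVlt; apply/orP; left; apply/eqP.
apply: eq_eseriesr => N _; apply: eq_integral => w _.
rewrite -coin_run_query_cst -coin_run_sum; congr EFin.
apply: eq_coin_run => m h; rewrite /query_weight.
by case: act => [q k|i]; [exact: pc|rewrite big1].
Qed.

End Coin_output.

(** * Group privacy and the planted mechanism *)

Section Hamming_distance.
Context (D : eqType) (n : nat).
Implicit Types d e f : n.-tuple D.

Lemma hamming_sym d e : hamming d e = hamming e d.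
Proof. by apply: eq_card => i; rewrite !inE eq_sym. Qed.

Lemma hamming_triangle d e f : (hamming d f <= hamming d e + hamming e f)%N.
Proof.
apply: leq_trans (leq_card_setU _ _); apply: subset_leq_card.
apply/fintype.subsetP => i; rewrite !inE.
case: (eqVneq (tnth d i) (tnth e i)) => //= de.
by rewrite de.
Qed.

Lemma hamming_le d e : (hamming d e <= n)%N.
Proof. by rewrite -[leqRHS]card_ord max_card. Qed.

Lemma hamming_refl d : hamming d d = 0%N.
Proof. by apply: eq_card0 => i; rewrite !inE eqxx. Qed.

Lemma hamming_eq0 d e : hamming d e = 0%N -> d = e.
Proof.
move=> /eqP; rewrite cards_eq0 => /eqP de.
apply: eq_from_tnth => i; apply/eqP/negPn; move/setP/(_ i): de.
by rewrite !inE => ->.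
Qed.

Lemma hamming_step d e m : hamming d e = m.+1 ->
  exists2 f, neighboring d f & hamming f e = m.
Proof.
move=> dem.
have /card_gt0P[i] : (0 < hamming d e)%N by rewrite dem.
rewrite inE => dei.
exists [tuple if j == i then tnth e j else tnth d j | j < n].
  rewrite /neighboring /hamming (_ : [set _ | _]%SET = [set i]%SET) ?cards1//.
  apply/setP => j; rewrite !inE tnth_mktuple; case: (eqVneq j i) => [->//|_].
  by rewrite eqxx.
apply/eqP; rewrite -eqSS -dem /hamming (cardsD1 i [set j | tnth d j != _]%SET).
rewrite inE dei add1n; apply/eqP; congr _.+1; apply: eq_card => j.
by rewrite !inE tnth_mktuple; case: (eqVneq j i) => [->|_]; rewrite ?eqxx.
Qed.

Lemma group_privacy (R : realType) (P : n.-tuple D -> R) (a delta : R) :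
  0 <= a -> 0 <= delta ->
  (forall d e, neighboring d e -> P d <= expR a * P e + delta) ->
  forall d e, P d <= expR (a * (hamming d e)%:R) *
                     (P e + (hamming d e)%:R * delta).
Proof.
move=> a0 delta0 Pde d e; move: {2}(hamming d e) (erefl (hamming d e)) => m.
elim: m d => [|m IHm] d dem.
  by rewrite dem (hamming_eq0 dem) mulr0 expR0 mul1r mul0r addr0.
have [f df fem] := hamming_step dem.
apply: (le_trans (Pde _ _ df)); have := IHm _ fem; rewrite fem dem => Pf.
have E1 : expR (a * m.+1%:R) = expR a * expR (a * m%:R) :> R.
  by rewrite -expRD -natr1; congr expR; ring.
(* The [delta] added by the new step is enlarged to [delta] times the full exponential, so that all
   errors share one factor. *)
have E2 : 1 <= expR (a * m.+1%:R) :> R by rewrite -expR0 ler_expR mulr_ge0.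
apply: (@le_trans _ _
  (expR a * (expR (a * m%:R) * (P e + m%:R * delta)) + delta)).
  by rewrite lerD2r ler_wpM2l// expR_ge0.
rewrite mulrA -E1; move: E2; set E := expR _ => E2.
by rewrite -natr1 mulrDl mul1r addrA [leRHS]mulrDr lerD2l ler_peMl.
Qed.

End Hamming_distance.

Section Planted_mechanism.
Context (R : realType) (K n : nat) (eps : R).
Hypothesis eps_ge0 : 0 <= eps.
Implicit Types (s : 'I_K * n.-tuple bool) (q : n.-tuple bool).

(* The mechanism that succeeds with probability 1/2 at the secret setting
   [s.1] and dataset [s.2], and whose success probability decays as fast as
   privacy permits away from [s.2]. *)
Definition planted s (k : 'I_K) q : R :=
  if k == s.1 then expR (- eps * (hamming q s.2)%:R) / 2 else 0.

Lemma planted_half s k q : 0 <= planted s k q <= 2^-1.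
Proof.
rewrite /planted; case: ifP => _; last by apply/andP; split; lra.
have : expR (- eps * (hamming q s.2)%:R) <= 1.
  by rewrite -expR0 ler_expR mulNr oppr_le0 mulr_ge0.
have := expR_ge0 (- eps * (hamming q s.2)%:R).
by move=> E0 E1; apply/andP; split; lra.
Qed.

Lemma planted01 s k q : 0 <= planted s k q <= 1.
Proof.
have /andP[-> p2] := planted_half s k q; lra.
Qed.

Lemma le_planted s k q q' : neighboring q q' ->
  planted s k q <= expR eps * planted s k q'.
Proof.
move=> qq'; rewrite /planted; case: ifP => _; last by rewrite mulr0.
rewrite mulrA ler_pM2r ?invr_gt0// -expRD ler_expR.
have : (hamming q' s.2 <= 1 + hamming q s.2)%N.
  by have := hamming_triangle q' q s.2; rewrite (hamming_sym q' q) qq'.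
rewrite -(ler_nat R) natrD => /(ler_wpM2l eps_ge0); lra.
Qed.

(** Every event has a probability that is a nonnegative combination of those of the two answers, so
    privacy need only be checked on each answer. *)
Lemma diff_private_coin (p : 'I_K -> n.-tuple bool -> R) :
  (forall k q, 0 <= p k q <= 1) ->
  (forall k q q', neighboring q q' -> p k q <= expR eps * p k q') ->
  (forall k q q', neighboring q q' -> 1 - p k q <= expR eps * (1 - p k q')) ->
  mechanism_private eps (coin_mechanism p).
Proof.
move=> p01 p_le pC_le k q q' qq' S mS.
rewrite [coin_mechanism _ _ _ _]coinE// [coin_mechanism _ _ q' _]coinE//.
rewrite -EFinM -EFinD lee_fin addr0 mulrDr !mulrA.
by apply: lerD; rewrite ler_wpM2r//; [exact: p_le|exact: pC_le].
Qed.

Lemma planted_private s : mechanism_private eps (coin_mechanism (planted s)).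
Proof.
apply: diff_private_coin => [k q|k q q'|k q q' qq'].
- exact: planted01.
- exact: le_planted.
have p'p : planted s k q' <= expR eps * planted s k q.
  apply: le_planted; rewrite /neighboring hamming_sym; exact: qq'.
have /andP[p'0 p'2] := planted_half s k q'.
have E1 : 1 <= expR eps by rewrite -expR0 ler_expR.
set E := expR eps in p'p E1 *.
set u := planted s k q in p'p *; set u' := planted s k q' in p'p p'0 p'2 *.
have u'E : u' * (E ^+ 2 - 1) <= 2^-1 * (E ^+ 2 - 1).
  by apply: ler_wpM2r => //; nra.
(* The factor [E] makes [E * u] appear, which is at least [u']. The right-hand side is then at least
   [E ^+ 2 - E - u' * (E ^+ 2 - 1)], hence at least [(E - 1) ^+ 2 / 2] as [u' <= 1/2]. *)
suff : 0 <= E * (E * (1 - u') - 1 + u) by rewrite pmulr_rge0; [lra|lra].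
have : 0 <= (E - 1) ^+ 2 by exact: sqr_ge0.
nra.
Qed.

Lemma zero_private : mechanism_private eps
  (coin_mechanism (fun (_ : 'I_K) (_ : n.-tuple bool) => 0 : R)).
Proof.
apply: diff_private_coin => [k q|k q q' _|k q q' _].
- by rewrite lexx ler01.
- by rewrite mulr0.
- by rewrite subr0 mulr1 -expR0 ler_expR.
Qed.

(** Only the secrets with first component [k] contribute. Over the secret datasets the weight
    factors by coordinate: 1 for agreement with [q], [expR (- eps)] for disagreement. The total thus
    does not depend on the query. *)
Lemma sum_planted k q :
  \sum_s planted s k q = (1 + expR (- eps)) ^+ n / 2.
Proof.
rewrite -(pair_bigA _ (fun k' d => planted (k', d) k q))/=.
rewrite (bigD1 k)//= [X in _ + X]big1 ?addr0; last first.
  by move=> k' /negPf k'k; apply: big1 => d _; rewrite /planted/= eq_sym k'k.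
rewrite /planted/= eqxx -mulr_suml; congr (_ / 2).
pose w (i : 'I_n) (b : bool) : R := if tnth q i != b then expR (- eps) else 1.
have wE d : expR (- eps * (hamming q d)%:R) = \prod_(i < n) w i (tnth d i).
  rewrite expRM_natr -[RHS]big_mkcond/= prodr_const.
  by congr (_ ^+ _); apply: eq_card => i; rewrite !inE.
under eq_bigr do rewrite wE.
have -> : (1 + expR (- eps)) ^+ n = \prod_(i < n) \sum_(b : bool) w i b.
  rewrite -[in LHS](card_ord n) -prodr_const; apply: eq_bigr => i _.
  by rewrite big_bool /w; case: (tnth q i); rewrite //= addrC.
rewrite bigA_distr_bigA/=.
rewrite (reindex (fun f : {ffun 'I_n -> bool} => tuple_of_finfun f)).
  by apply: eq_bigr => f _; apply: eq_bigr => i _; rewrite tnth_mktuple.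
exists (@finfun_of_tuple _ _) => f _; first exact: tuple_of_finfunK.
exact: finfun_of_tupleK.
Qed.

(** At its own secret the mechanism answers 1 with probability exactly 1/2, the threshold in
    [median]. *)
Lemma median_planted s :
  (1%:E <= median (coin_mechanism (planted s) s.1 s.2))%E.
Proof.
apply: ereal_sup_ubound; exists 1 => //=.
rewrite [leRHS]coinE; last exact: planted01.
rewrite lee_fin /planted eqxx hamming_refl mulr0 expR0 !indicE.
rewrite mem_set/= ?lexx// memNset/= ?ler10//.
by rewrite mul1r mulr1 mulr0 addr0.
Qed.

End Planted_mechanism.

(** * Choice of the dimension *)

Section Choice_of_dimension.
Context (R : realType).
Implicit Types eps T : R.

(** For [eps <= 3], [(1 + eps) * (1 - eps / 4) = 1 + eps * (3 - eps) / 4] is at least 1, so [expR (-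
    eps) <= 1 / (1 + eps) <= 1 - eps / 4]; the mean is then at most [1 - eps / 8]. *)
Lemma mean_expRN_le eps : 0 <= eps <= 3 ->
  (1 + expR (- eps)) / 2 <= expR (- (eps / 8)).
Proof.
move=> /andP[eps0 eps3].
have E1 : 1 + eps <= expR eps by exact: expR_ge1Dx.
have E0 : 0 < expR (- eps) by exact: expR_gt0.
have E2 : expR (- eps) * expR eps = 1 by rewrite -expRD addNr expR0.
have E3 : expR (- eps) * (1 + eps) <= 1 by rewrite -[leRHS]E2 ler_pM2l.
have : expR (- eps) <= 1 - eps / 4.
  rewrite -(@ler_pM2r _ (1 + eps)); last lra.
  by apply: (le_trans E3); nra.
have := expR_ge1Dx (- (eps / 8)); lra.
Qed.

(** Take for [n] the least integer above [8 * ln T / eps]. Then [expR (- (n * eps / 8)) <= 1 / T],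
    while rounding up costs at most [eps <= ln T], whence the 9. *)
Lemma exists_dimension eps T : 0 < eps <= 3 -> expR eps <= T ->
  exists n : nat, [/\ (0 < n)%N, n%:R * eps <= 9 * ln T &
    T * (1 + expR (- eps)) ^+ n <= 2 ^+ n].
Proof.
move=> /andP[eps0 eps3] epsT.
have T0 : 0 < T by apply: lt_le_trans epsT; exact: expR_gt0.
have lnT : eps <= ln T by rewrite -[leLHS]expRK ler_ln ?posrE ?expR_gt0//.
have x0 : 0 <= 8 * ln T / eps by rewrite divr_ge0 ?mulr_ge0//; lra.
have /andP[n1 n2] := truncn_itv x0.
set n := Num.truncn _ in n1 n2.
exists n.+1; split => //.
  by move: n1; rewrite ler_pdivlMr// -natr1; lra.
move: n2; rewrite ltr_pdivrMr// => n2.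
have bern : ((1 + expR (- eps)) / 2) ^+ n.+1 <= T^-1.
  apply: (@le_trans _ _ (expR (- (eps / 8)) ^+ n.+1)).
    rewrite lerXn2r ?nnegrE ?divr_ge0 ?addr_ge0 ?expR_ge0//.
    by apply: mean_expRN_le; rewrite ltW.
  rewrite -expRM_natr -[T in leRHS]lnK ?posrE// -expRN ler_expR; lra.
move: bern; rewrite expr_div_n ler_pdivrMr ?exprn_gt0//.
by rewrite [leRHS]mulrC ler_pdivlMr// mulrC.
Qed.

End Choice_of_dimension.

(** * Contradiction between utility, runtime and privacy *)

Lemma measurable_score_ge (R : realType) (y : \bar R) :
  measurable [set ov : unit * R | (y <= ov.2%:E)%E].
Proof.
rewrite -[X in measurable X]setTI.
rewrite (_ : [set ov | _] = (EFin \o snd) @^-1` [set z | (y <= z)%E])//.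
have : measurable_fun [set: unit * R] (EFin \o @snd unit R).
  by apply/measurable_EFinP; exact: measurable_snd.
apply => //.
rewrite (_ : [set z | _] = `[y, +oo[%classic); first exact: emeasurable_itv.
by apply/seteqP; split => z /=; rewrite in_itv/= andbT.
Qed.

Theorem mainTheorem2 (R : realType) (eps c delta gamma T : R) (K : nat)
  (eps_gt0 : 0 < eps) (c_gt0 : 0 < c) (delta_ge0 : 0 <= delta)
  (gamma_gt0 : 0 < gamma) (gamma_lt1 : gamma < 1) (T_ge : expR eps <= T)
  (K_gt0 : (0 < K)%N)
  (A : forall (dD : measure_display) (D : measurableType dD) (n : nat)
         (dO : measure_display) (O : measurableType dO),
       oracle_alg R K n D (O * R)%type)
  (privacy : forall (dD : measure_display) (D : measurableType dD) (n : nat)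
      (dO : measure_display) (O : measurableType dO)
      (M : 'I_K -> R.-pker (n.-tuple D) ~> (O * R)%type),
    (0 < n)%N -> mechanism_private eps M ->
    diff_private (c * eps) delta (output_prob (A dD D n dO O) M))
  (utility : forall (dD : measure_display) (D : measurableType dD) (n : nat)
      (dO : measure_display) (O : measurableType dO)
      (M : 'I_K -> R.-pker (n.-tuple D) ~> (O * R)%type),
    (0 < n)%N -> mechanism_private eps M ->
    forall d : n.-tuple D,
    ((1 - gamma)%:E <= output_prob (A dD D n dO O) M d
       [set ov | (\big[maxe/-oo]_(k < K) median (M k d) <= ov.2%:E)%E])%E)
  (runtime : forall (dD : measure_display) (D : measurableType dD) (n : nat)
      (dO : measure_display) (O : measurableType dO)
      (M : 'I_K -> R.-pker (n.-tuple D) ~> (O * R)%type),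
    (0 < n)%N -> mechanism_private eps M ->
    forall d : n.-tuple D,
    (expected_calls (A dD D n dO O) M d <= (T * K%:R)%:E)%E) :
  eps <= 3 -> delta < eps * gamma / (40 * ln (8 * T)) ->
  8^-1 * (8 * gamma) `^ (- (40 * c)^-1) <= T /\
  ln (8 * gamma)^-1 / (40 * ln (8 * T)) <= c.
Proof.
move=> eps_le3 delta_lt.
have T_gt0 : 0 < T by apply: lt_le_trans T_ge; exact: expR_gt0.
have T8_gt0 : 0 < 8 * T by rewrite mulr_gt0.
have lnT : eps <= ln T by rewrite -[leLHS]expRK ler_ln ?posrE ?expR_gt0//.
have lnT8 : ln T < ln (8 * T) by rewrite ltr_ln ?posrE//; lra.
have L_gt0 : 0 < ln (8 * T) by lra.
set L := ln (8 * T) in delta_lt lnT8 L_gt0 *.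
have gamma8_gt0 : 0 < 8 * gamma by rewrite mulr_gt0.
(* Both conclusions are rearrangements of this inequality. *)
suff gcL : ln (8 * gamma)^-1 <= c * (40 * L).
  split; last by rewrite ler_pdivrMr// mulr_gt0.
  rewrite /powR gt_eqF// ler_pdivrMl// -[8 * T]lnK ?posrE// ler_expR -/L.
  rewrite mulNr -mulrN -lnV ?posrE// ler_pdivrMl ?mulr_gt0//; lra.
have [gamma8_ge1|gamma8_lt1] := leP 1 (8 * gamma).
  rewrite lnV ?posrE//; apply: (@le_trans _ _ 0).
    by rewrite oppr_le0 ln_ge0.
  by rewrite !mulr_ge0// ltW.
rewrite leNgt; apply/negP => c_lt.
have [n [n_gt0 n_le n_hit]] : exists n : nat, [/\ (0 < n)%N,
    n%:R * eps <= 9 * ln T & T * (1 + expR (- eps)) ^+ n <= 2 ^+ n].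
  by apply: exists_dimension => //; rewrite eps_gt0.
have eps_ge0 := ltW eps_gt0.
pose B := A _ bool n _ unit.
pose d0 : n.-tuple bool := [tuple of nseq n false].
pose out s d S := output_prob B (coin_mechanism (planted eps s)) d S.
pose high := [set ov : unit * R | (1%:E <= ov.2%:E)%E].
have mhigh : measurable high by exact: measurable_score_ge.
have mlow : measurable (~` high) by exact: measurableC.
have p01 (s : 'I_K * n.-tuple bool) k q : 0 <= planted eps s k q <= 1.
  exact: planted01.
(* Utility bounds from below the probability of returning at all, on every dataset; this is applied
   at [d0]. *)
have utility_total s d : ((1 - gamma)%:E <= out s d setT)%E.
  apply: (le_trans (utility _ _ _ _ _ _ n_gt0 (planted_private eps_ge0 s) d)).
  by apply: le_output_prob => //; exact: measurable_score_ge.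
have utility_high s : ((1 - gamma)%:E <= out s s.2 high)%E.
  apply: (le_trans (utility _ _ _ _ _ _ n_gt0 (planted_private eps_ge0 s) s.2)).
  apply: le_output_prob => //; first exact: measurable_score_ge.
  (* A score above the maximum of the medians is above the median at [k = s.1], hence at least 1. *)
  move=> ov; apply: le_trans; apply: (le_trans (median_planted eps_ge0 s)).
  exact: (le_bigmax _ (fun k => median (coin_mechanism (planted eps s) k s.2))).
have out_fin s d S : measurable S -> out s d S = (fine (out s d S))%:E.
  move=> mS; rewrite fineK// ge0_fin_numE; last exact: output_prob_ge0.
  by apply: le_lt_trans (output_prob_le1 _ _ _ mS) _ => //; rewrite ltry.
(* Averaging over the [K * 2 ^+ n] secrets: by the runtime on the all-zero mechanism and the choice
   of [n], the mean of [out s d0 high] is at most 1/2, which is below 5/8. *)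
have [s out_s] : exists s, (out s d0 high <= (5 / 8)%:E)%E.
  apply: contrapT => /forallNP out_gt.
  have : ((K%:R * 2 ^+ n * (5 / 8))%:E <=
          ((1 + expR (- eps)) ^+ n / 2)%:E * (T * K%:R)%:E)%E.
    apply: (@le_trans _ _ (\sum_(s : 'I_K * n.-tuple bool) out s d0 high)%E).
      apply: (@le_trans _ _ (\sum_(s : 'I_K * n.-tuple bool) (5 / 8)%:E)%E).
        rewrite sumEFin sumr_const card_prod card_ord card_tuple card_bool.
        by rewrite lee_fin -[leRHS]mulr_natl natrM natrX.
      by apply: lee_sum => s _; rewrite ltW// ltNge; apply/negP/out_gt.
    have C_ge0 : 0 <= (1 + expR (- eps)) ^+ n / 2.
      by rewrite divr_ge0// exprn_ge0// addr_ge0// expR_ge0.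
    have low0 : ~ high (answer R false).
      by rewrite /high/= lee_fin; apply/negP; rewrite -ltNge ltr01.
    apply: (le_trans (sum_output_prob_hit B d0 p01 mhigh low0 C_ge0
      (@sum_planted _ _ _ eps))).
    rewrite lee_wpmul2l//.
    exact: (runtime _ _ _ _ _ _ n_gt0 (zero_private eps_ge0) d0).
  rewrite -EFinM lee_fin.
  have K0 : 0 < K%:R :> R by rewrite ltr0n.
  have twon : 0 < 2 ^+ n :> R by rewrite exprn_gt0.
  have := ler_wpM2l (ltW K0) n_hit; have := mulr_gt0 K0 twon; lra.
have [P PE] : exists P : n.-tuple bool -> R,
    forall d, out s d (~` high) = (P d)%:E.
  by exists (fun d => fine (out s d (~` high))) => d; exact: out_fin.
have splitE d : out s d high + out s d (~` high) = out s d setT.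
  exact: output_probC.
have P_s2 : P s.2 <= gamma.
  have : (out s s.2 high + out s s.2 (~` high) <= 1)%E.
    by rewrite splitE; exact: output_prob_le1.
  have := utility_high s; rewrite PE (out_fin _ _ _ mhigh) -EFinD !lee_fin.
  by move: (fine _) => v; lra.
have P_d0 : 1 - gamma - 5 / 8 <= P d0.
  have := utility_total s d0; move: out_s.
  rewrite -splitE PE (out_fin _ _ _ mhigh) -EFinD !lee_fin.
  by move: (fine _) => v; lra.
have P_private d d' : neighboring d d' -> P d <= expR (c * eps) * P d' + delta.
  move=> dd'.
  have := privacy _ _ _ _ _ _ n_gt0 (planted_private eps_ge0 s) _ _ dd' _ mlow.
  by rewrite -!/(out _ _ _) !PE -EFinM -EFinD lee_fin.
have ceps_ge0 : 0 <= c * eps by rewrite mulr_ge0// ltW.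
have := group_privacy ceps_ge0 delta_ge0 P_private d0 s.2.
have : (hamming d0 s.2)%:R <= n%:R :> R by rewrite ler_nat hamming_le.
have : 0 <= (hamming d0 s.2)%:R :> R by exact: ler0n.
move: (hamming d0 s.2)%:R => h h_ge0 h_le P_le.
(* With [h <= n], the exponent [c * eps * h] is at most [9 * c * L], below the [40 * c * L] of the
   negated goal, and the bound on [delta] gives [h * delta <= 9 / 40 * gamma]. *)
have heps : h * eps <= 9 * L by nra.
have expR_le : expR (c * eps * h) <= (8 * gamma)^-1.
  by rewrite -[leRHS]lnK ?posrE ?invr_gt0// ler_expR; nra.
have hdelta : h * delta <= gamma * (9 / 40).
  move: delta_lt; rewrite ltr_pdivlMr ?mulr_gt0// => delta_lt.
  rewrite -(@ler_pM2r _ (40 * L)) ?mulr_gt0//; nra.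
have Pgd : P s.2 + h * delta <= gamma * (49 / 40) by lra.
have : P d0 <= (8 * gamma)^-1 * (gamma * (49 / 40)).
  apply: (le_trans P_le).
  apply: (@le_trans _ _ (expR (c * eps * h) * (gamma * (49 / 40)))).
    by rewrite ler_wpM2l// expR_ge0.
  by rewrite ler_wpM2r// mulr_ge0// ltW.
(* As [gamma < 1/8], [P_d0] gives [P d0 >= 3/8 - gamma > 1/4], which exceeds 49/320. *)
have -> : (8 * gamma)^-1 * (gamma * (49 / 40)) = 49 / 320.
  by field; rewrite gt_eqF.
lra.
Qed.
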